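(* Let $A$ be a weighted $\mathbb{N}$-filtered solvable polynomial algebra with the $\mathbb{N}$-filtration $FA=\{F_pA\}_{p\in\mathbb{N}}$ constructed with respect to a given positive-degree function $d(~)$ on $A$. Let $M$ be a filtered $A$-module with the filtration $FM=\{F_qM\}_{q\in\mathbb{N}}$, and $V=\{v_1,\ldots,v_m\}\subset M$ a subset of nonzero elements. Then $V$ is a minimal F-basis of $M$ with respect to $FM$ if and only if $\sigma(V)=\{\sigma(v_1),\ldots,\sigma(v_m)\}$ is a minimal homogeneous generating set of $G(M)$ if and only if $\tau(V)=\{\widetilde{v}_1,\ldots,\widetilde{v}_m\}$ is a minimal homogeneous generating set of $\widetilde{M}$. Hence, any two minimal F-bases of $M$ with respect to $FM$ have the same number of elements and the same number of elements of the same filtered degree.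
   Context: $K$ is a field, $\mathbb{N}$ the nonnegative integers, modules are left unitary modules. Solvable polynomial algebra: a $K$-algebra $A=K[a_1,\ldots,a_n]$ with minimal generating set $\{a_1,\ldots,a_n\}$ having $K$-basis $\mathscr{B}=\{a^\alpha=a_1^{\alpha_1}\cdots a_n^{\alpha_n}\mid\alpha=(\alpha_1,\ldots,\alpha_n)\in\mathbb{N}^n\}$ and a total ordering $\prec$ on $\mathscr{B}$ such that, writing $\mathbf{LM}(f)$ for the $\prec$-largest monomial occurring in $f\neq0$: (1) $\prec$ is a well-ordering; (2) $a^\alpha\prec a^\beta$ and $\mathbf{LM}(a^\gamma a^\alpha a^\eta),\mathbf{LM}(a^\gamma a^\beta a^\eta)\notin K$ imply $\mathbf{LM}(a^\gamma a^\alpha a^\eta)\prec\mathbf{LM}(a^\gamma a^\beta a^\eta)$; (3) if $a^\beta\ne a^\gamma$ and $a^\gamma=\mathbf{LM}(a^\alpha a^\beta a^\eta)$ then $a^\beta\prec a^\gamma$; and for all $\alpha,\beta$, $a^\alpha a^\beta=\lambda_{\alpha,\beta}a^{\alpha+\beta}+f_{\alpha,\beta}$ with $\lambda_{\alpha,\beta}\in K\setminus\{0\}$ and $f_{\alpha,\beta}=0$ or $\mathbf{LM}(f_{\alpha,\beta})\prec a^{\alpha+\beta}$. A positive-degree function $d(~)$ is given by positive integers $d(a_i)=m_i$, with $d(a^\alpha)=\sum_i m_i\alpha_i$. $A$ is a weighted $\mathbb{N}$-filtered solvable polynomial algebra with respect to $d(~)$ if the subspaces $F_pA=K\text{-span}\{a^\alpha\in\mathscr{B}\mid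 d(a^\alpha)\le p\}$ satisfy $F_pAF_qA\subseteq F_{p+q}A$ for all $p,q\in\mathbb{N}$. A filtered $A$-module $M$ is an $A$-module with $K$-subspaces $F_qM$ ($q\in\mathbb{N}$) such that $F_qM\subseteq F_{q+1}M$, $\cup_qF_qM=M$, and $F_pAF_qM\subseteq F_{p+q}M$ for all $p,q\in\mathbb{N}$; put $F_{-1}M=0$, $F_{-1}A=0$. For $0\ne\xi\in M$, the filtered degree $d_{\rm fil}(\xi)=q$ means $\xi\in F_qM\setminus F_{q-1}M$. The associated graded algebra and module are $G(A)=\oplus_pF_pA/F_{p-1}A$ and $G(M)=\oplus_qF_qM/F_{q-1}M$ (a graded $G(A)$-module). The Rees algebra and module are $\widetilde{A}=\oplus_pF_pA$ and $\widetilde{M}=\oplus_qF_qM$ (external direct sums graded by $p$ and $q$; $\widetilde{M}$ is a graded $\widetilde{A}$-module). For $\xi$ with $d_{\rm fil}(\xi)=q$, $\sigma(\xi)=\xi+F_{q-1}M\in G(M)_q$, and $\widetilde{\xi}$ is the element $\xi$ viewed in $\widetilde{M}_q=F_qM$. F-basis: a finite subset $V=\{v_1,\ldots,v_m\}$ of nonzero elements of $M$ is an F-basis of $M$ with respect to $FM$ if it satisfies one of the following equivalent conditions: (i) there is a subset $\{n_1,\ldots,n_m\}\subset\mathbb{N}$ with $F_qM=\sum_{i=1}^m\left(\sum_{p_i+n_i\le q}F_{p_i}A\right)v_i$ for all $q\in\mathbb{N}$; (ii) $G(M)=\sum_{i=1}^mG(A)\sigma(v_i)$; (iii) $\widetilde{M}=\sum_{i=1}^m\widetilde{A}\,\widetilde{v}_i$.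 An F-basis is minimal if no proper subset of it is an F-basis of $M$ with respect to $FM$. A minimal homogeneous generating set of a graded module is a generating set consisting of homogeneous elements no proper subset of which generates the module.
   Formalization: The condition on σ(V) also requires σ(v_1),…,σ(v_m) to be pairwise distinct; read as a plain set the claim fails, e.g. for V={e,f,e+f} in the free module on e of degree 0 and f of degree 1. *)

(* Defs.v *)
From HB Require Import structures.
From mathcomp Require Import all_boot all_order all_algebra finmap.
From mathcomp Require Import boolp classical_sets.

Set Implicit Arguments.
Unset Strict Implicit.
Unset Printing Implicit Defensive.

Import Order.TTheory GRing.Theory.

Local Open Scope classical_set_scope.
Local Open Scope ring_scope.

Section Span.
Variables (K : fieldType) (A : lmodType K).

Definition Kspan (S : set A) : set A :=
  [set f | exists s : seq (K * A),
    (forall x, x \in s -> S x.2) /\ f = \sum_(x <- s) x.1 *: x.2].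

Lemma Kspan0 S : Kspan S 0.
Proof. by exists [::]; split=> //; rewrite big_nil. Qed.

Lemma KspanZD S (k : K) f g : Kspan S f -> Kspan S g -> Kspan S (k *: f + g).
Proof.
move=> [s [Ss ->]] [t [St ->]].
exists ([seq (k * x.1, x.2) | x <- s] ++ t); split.
  by move=> x; rewrite mem_cat => /orP[/mapP[y /Ss ys ->]|/St].
rewrite big_cat big_map /= scaler_sumr; congr (_ + _).
by apply: eq_bigr => x _; rewrite scalerA.
Qed.

Lemma sub_Kspan (S T : set A) : S `<=` T -> Kspan S `<=` Kspan T.
Proof. by move=> ST f [s [Ss ->]]; exists s; split=> // x /Ss /ST. Qed.

End Span.

Section Solvable.
Variables (K : fieldType) (A : algType K) (n : nat) (a : 'I_n -> A).

Definition expo := {ffun 'I_n -> nat}.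
Definition expo_add (al be : expo) : expo := [ffun i => (al i + be i)%N].

(* The product is taken in the order of the indices: a_1^al_1 ... a_n^al_n. *)
Definition mon (al : expo) : A := \prod_(i < n) a i ^+ al i.

Definition mon_basis : Prop :=
  Kspan (range mon) = setT /\
  (forall (s : {fset expo}) (c : expo -> K),
     \sum_(al <- s) c al *: mon al = 0 -> forall al, al \in s -> c al = 0).

Definition generates_algebra (S : set A) : Prop :=
  forall B : set A, B 1 ->
    (forall (k : K) x y, B x -> B y -> B (k *: x + y)) ->
    (forall x y, B x -> B y -> B (x * y)) ->
    S `<=` B -> B = setT.

Definition minimal_algebra_generators : Prop :=
  generates_algebra (range a) /\
  (forall S : set A, S `<` range a -> ~ generates_algebra S).

(* Since al |-> mon al is injective when [mon_basis] holds, an ordering on the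
   set of monomials is the same thing as an ordering on the exponents. *)
Variable prec : rel expo.

Definition strict_total_order : Prop :=
  [/\ irreflexive prec, transitive prec
    & forall al be, al != be -> prec al be || prec be al].

Definition well_ordering : Prop :=
  forall S : set expo, S !=set0 ->
    exists2 mu, S mu & forall al, S al -> mu = al \/ prec mu al.

(* [is_LM f mu]: f is nonzero and LM(f) = a^mu. *)
Definition is_LM (f : A) (mu : expo) : Prop :=
  exists (s : {fset expo}) (c : expo -> K),
    [/\ f = \sum_(al <- s) c al *: mon al,
        forall al, al \in s -> c al != 0,
        mu \in s
      & forall al, al \in s -> al = mu \/ prec al mu].

Definition scalar (x : A) : Prop := exists k : K, x = k%:A.

Record solvable_polynomial_algebra : Prop := {
  spa_generators : minimal_algebra_generators;
  spa_basis : mon_basis;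
  spa_order : strict_total_order;
  spa_well_order : well_ordering;
  spa_compatible : forall al be ga eta mu nu,
    prec al be ->
    is_LM (mon ga * mon al * mon eta) mu ->
    is_LM (mon ga * mon be * mon eta) nu ->
    ~ scalar (mon mu) -> ~ scalar (mon nu) -> prec mu nu;
  spa_factor : forall al be eta ga,
    mon be <> mon ga -> is_LM (mon al * mon be * mon eta) ga -> prec be ga;
  spa_product : forall al be, exists (lambda : K) (f : A),
    [/\ lambda != 0,
        mon al * mon be = lambda *: mon (expo_add al be) + f
      & f = 0 \/ exists2 mu, is_LM f mu & prec mu (expo_add al be)]
}.

Variable m : 'I_n -> nat.

Definition degree (al : expo) : nat := \sum_(i < n) m i * al i.

Definition weight_fil (p : nat) : set A :=
  Kspan [set f | exists2 al, (degree al <= p)%N & f = mon al].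

Definition weighted_filtered : Prop :=
  forall p q f g, weight_fil p f -> weight_fil q g -> weight_fil (p + q) (f * g).

End Solvable.

Record filtration (V : zmodType) := Filtration {
  fil :> nat -> set V;
  fil0 : forall p, fil p 0;
  filB : forall p x y, fil p x -> fil p y -> fil p (x - y);
  filS : forall p, fil p `<=` fil p.+1;
  fil_cover : forall x, exists p, fil p x
}.

Record alg_filtration (K : fieldType) (A : algType K) := AlgFiltration {
  alg_fil :> filtration A;
  alg_filZ : forall p (k : K) x, alg_fil p x -> alg_fil p (k *: x);
  alg_fil1 : alg_fil 0%N 1;
  alg_filM : forall p q x y,
    alg_fil p x -> alg_fil q y -> alg_fil (p + q)%N (x * y)
}.

(* The field K acts on an A-module through K -> A, k |-> k%:A. *)
Record mod_filtration (K : fieldType) (A : algType K) (FA : alg_filtration A)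
    (M : lmodType A) := ModFiltration {
  mod_fil :> filtration M;
  mod_filZ : forall q (k : K) x, mod_fil q x -> mod_fil q (k%:A *: x);
  mod_filM : forall p q x y,
    FA p x -> mod_fil q y -> mod_fil (p + q)%N (x *: y)
}.

Section WeightedFiltration.
Variables (K : fieldType) (A : algType K) (n : nat) (a : 'I_n -> A).
Variables (prec : rel (expo n)) (m : 'I_n -> nat).
Hypothesis solvA : solvable_polynomial_algebra a prec.
Hypothesis filA : weighted_filtered a m.

Let F := weight_fil a m.

Fact weight_fil0 p : F p 0. Proof. exact: Kspan0. Qed.

Fact weight_filB p x y : F p x -> F p y -> F p (x - y).
Proof. by move=> Fx Fy; rewrite addrC -scaleN1r; apply: KspanZD. Qed.

Fact weight_filS p : F p `<=` F p.+1.
Proof. by apply: sub_Kspan => f [al le_al ->]; exists al => //; apply: leqW. Qed.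

Fact weight_fil_cover x : exists p, F p x.
Proof.
have [+ _] := spa_basis solvA.
move=> /seteqP[_ /(_ x I)] [s [Ss ->]]; elim: s Ss => [|y s IHs] Ss.
  by exists 0%N; rewrite big_nil; apply: weight_fil0.
have [p Fp] : exists p, F p (\sum_(x <- s) x.1 *: x.2).
  by apply: IHs => z zs; apply: Ss; rewrite inE zs orbT.
have [al _ def_al] : range (mon a) y.2 by apply: Ss; rewrite inE eqxx.
exists (maxn p (degree m al)); rewrite big_cons; apply: KspanZD.
  exists [:: (1, y.2)]; split; last by rewrite big_seq1 scale1r.
  by move=> z; rewrite inE => /eqP->; exists al => //; apply: leq_maxr.
apply: sub_Kspan Fp => f [be le_be ->]; exists be => //.
by rewrite leq_max le_be.
Qed.

Definition weight_base_filtration : filtration A :=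
  Filtration weight_fil0 weight_filB weight_filS weight_fil_cover.

Fact weight_filZ p (k : K) x : F p x -> F p (k *: x).
Proof. by move=> Fx; rewrite -[_ *: _]addr0; apply/KspanZD/weight_fil0. Qed.

Fact weight_fil1 : F 0%N 1.
Proof.
exists [:: (1, 1)]; split; last by rewrite big_seq1 scale1r.
move=> x; rewrite inE => /eqP->; exists [ffun=> 0%N].
  by rewrite leqn0 sum_nat_eq0; apply/forallP => i; rewrite ffunE muln0.
by rewrite /mon big1 // => i _; rewrite ffunE expr0.
Qed.

Definition weight_filtration : alg_filtration A :=
  @AlgFiltration K A weight_base_filtration weight_filZ weight_fil1 filA.

End WeightedFiltration.

Section Graded.
Variables (V : zmodType) (F : filtration V).

Lemma filN p x : F p x -> F p (- x).
Proof. by move=> Fx; rewrite -sub0r; apply: filB => //; apply: fil0. Qed.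

Lemma filD p x y : F p x -> F p y -> F p (x + y).
Proof. by move=> Fx /filN Fy; rewrite -[y]opprK; apply: filB. Qed.

Lemma fil_sum p (I : Type) (r : seq I) (P : pred I) (E : I -> V) :
  (forall i, P i -> F p (E i)) -> F p (\sum_(i <- r | P i) E i).
Proof.
by move=> FE; apply: big_ind => //; [apply: fil0 | move=> *; apply: filD].
Qed.

(* [fil_pred q] is F_(q-1), with F_(-1) = 0. *)
Definition fil_pred (q : nat) : set V := if q is p.+1 then F p else [set 0].

Lemma fil_pred_sub q : fil_pred q `<=` F q.
Proof. by case: q => [x ->|q]; [apply: fil0 | apply: filS]. Qed.

Lemma fil_pred0 q : fil_pred q 0.
Proof. by case: q => [//|q]; apply: fil0. Qed.

Lemma fil_predB q x y : fil_pred q x -> fil_pred q y -> fil_pred q (x - y).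
Proof. by case: q => [-> ->|q]; [rewrite /= subr0 | apply: filB]. Qed.

Lemma fil_predD q x y : fil_pred q x -> fil_pred q y -> fil_pred q (x + y).
Proof. by case: q => [-> ->|q]; [rewrite /= addr0 | apply: filD]. Qed.

(* Elements of the external direct sum of the F_p: finitely supported families
   (u_p) with u_p in F_p. *)
Record rees := Rees {
  rees_val :> nat -> V;
  rees_in : forall p, F p (rees_val p);
  rees_fin : exists N, forall p, (N <= p)%N -> rees_val p = 0
}.

Lemma reesP (u v : rees) : (forall p, u p = v p) -> u = v.
Proof.
case: u v => u u1 u2 [v v1 v2] /= uv.
have {}uv: u = v by apply/funext.
by case: _ / uv v1 v2 => v1 v2; congr Rees; apply: Prop_irrelevance.
Qed.

HB.instance Definition _ := gen_eqMixin rees.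
HB.instance Definition _ := gen_choiceMixin rees.

Definition rees_zero : rees.
Proof. by exists (fun=> 0); [move=> p; apply: fil0 | exists 0%N]. Defined.

Definition rees_opp (u : rees) : rees.
Proof.
exists (fun p => - u p); first by move=> p; apply/filN/rees_in.
by have [N uN] := rees_fin u; exists N => p /uN->; rewrite oppr0.
Defined.

Definition rees_add (u v : rees) : rees.
Proof.
exists (fun p => u p + v p); first by move=> p; apply: filD; apply: rees_in.
have [[N uN] [N' vN]] := (rees_fin u, rees_fin v).
by exists (maxn N N') => p; rewrite geq_max => /andP[/uN-> /vN->]; rewrite addr0.
Defined.

Fact rees_addA : associative rees_add.
Proof. by move=> u v w; apply: reesP => p /=; rewrite addrA. Qed.
Fact rees_addC : commutative rees_add.
Proof. by move=> u v; apply: reesP => p /=; rewrite addrC. Qed.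
Fact rees_add0 : left_id rees_zero rees_add.
Proof. by move=> u; apply: reesP => p /=; rewrite add0r. Qed.
Fact rees_addN : left_inverse rees_zero rees_opp rees_add.
Proof. by move=> u; apply: reesP => p /=; rewrite addNr. Qed.

HB.instance Definition _ :=
  GRing.isZmodule.Build rees rees_addA rees_addC rees_add0 rees_addN.

Definition rees_homog (q : nat) (x : V) (Fx : F q x) : rees.
Proof.
exists (fun p => if p == q then x else 0).
  by move=> p; case: eqP => [->|_] //; apply: fil0.
by exists q.+1 => p; case: eqP => [->|//]; rewrite ltnn.
Defined.

Definition rees_homogeneous : set rees :=
  [set u | exists q, forall p, p != q -> u p = 0].

Definition coset (N : set V) (x : V) : set V := [set y | N (y - x)].

Lemma coset0 N : coset N 0 = N.
Proof. by apply/seteqP; split=> x; rewrite /coset /= subr0. Qed.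

Lemma coset_eq p x y :
  coset (fil_pred p) x = coset (fil_pred p) y <-> fil_pred p (x - y).
Proof.
split=> [/seteqP[/(_ x) + _]|Nxy].
  by apply; rewrite /coset /= subrr; apply: fil_pred0.
apply/seteqP; split=> z; rewrite /coset /= => Nz.
  by rewrite -(subrKA x); apply: fil_predD.
rewrite -(subrKA y) -(opprB x y); exact: fil_predB.
Qed.

(* Elements of the external direct sum of the F_p / F_(p-1): finitely supported
   families of cosets; the zero of F_p / F_(p-1) is the coset F_(p-1). *)
Record gr := Gr {
  gr_val :> nat -> set V;
  gr_in : forall p, exists2 x, F p x & gr_val p = coset (fil_pred p) x;
  gr_fin : exists N, forall p, (N <= p)%N -> gr_val p = fil_pred p
}.

Lemma grP (u v : gr) : (forall p, u p = v p) -> u = v.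
Proof.
case: u v => u u1 u2 [v v1 v2] /= uv.
have {}uv: u = v by apply/funext.
by case: _ / uv v1 v2 => v1 v2; congr Gr; apply: Prop_irrelevance.
Qed.

HB.instance Definition _ := gen_eqMixin gr.
HB.instance Definition _ := gen_choiceMixin gr.

(* The class of a family of representatives. *)
Definition gr_class (u : rees) : gr.
Proof.
exists (fun p => coset (fil_pred p) (u p)).
  by move=> p; exists (u p) => //; apply: rees_in.
by have [N uN] := rees_fin u; exists N => p /uN->; rewrite coset0.
Defined.

Lemma gr_classP u v :
  gr_class u = gr_class v <-> forall p, fil_pred p (u p - v p).
Proof.
split=> [uv p | uv]; last by apply: grP => p; apply/coset_eq.
by apply/coset_eq; have /(congr1 (gr_val^~ p)) := uv.
Qed.

Lemma gr_class_surj (g : gr) : exists u, gr_class u = g.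
Proof.
have /choice[x xP] : forall p, exists x, F p x /\ g p = coset (fil_pred p) x.
  by move=> p; have [x Fx gx] := gr_in g p; exists x.
have [N gN] := gr_fin g.
have Fu p : F p (if (N <= p)%N then 0 else x p).
  by case: leqP => _; [apply: fil0 | have [] := xP p].
have u_fin : exists N', forall p, (N' <= p)%N -> (if (N <= p)%N then 0 else x p) = 0.
  by exists N => p ->.
exists (Rees Fu u_fin); apply: grP => p /=.
by case: leqP => [/gN->|_]; [rewrite coset0 | have [] := xP p].
Qed.

Definition gr_repr (g : gr) : rees := projT1 (cid (gr_class_surj g)).

Lemma gr_reprK g : gr_class (gr_repr g) = g.
Proof. exact: projT2 (cid (gr_class_surj g)). Qed.

Lemma gr_classK u p : fil_pred p (gr_repr (gr_class u) p - u p).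
Proof. by apply: (gr_classP _ _).1; rewrite gr_reprK. Qed.

Definition gr_zero := gr_class 0.
Definition gr_opp g := gr_class (- gr_repr g).
Definition gr_add g h := gr_class (gr_repr g + gr_repr h).

Lemma gr_addE u v : gr_add (gr_class u) (gr_class v) = gr_class (u + v).
Proof.
apply/gr_classP => p /=; rewrite opprD addrACA.
by apply: fil_predD; apply: gr_classK.
Qed.

Lemma gr_oppE u : gr_opp (gr_class u) = gr_class (- u).
Proof.
apply/gr_classP => p /=; rewrite -opprD -sub0r.
apply: fil_predB; [exact: fil_pred0 | exact: gr_classK].
Qed.

Fact gr_addA : associative gr_add.
Proof.
move=> u v w; rewrite -(gr_reprK u) -(gr_reprK v) -(gr_reprK w).
by rewrite !gr_addE addrA.
Qed.
Fact gr_addC : commutative gr_add.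
Proof. by move=> u v; rewrite /gr_add addrC. Qed.
Fact gr_add0 : left_id gr_zero gr_add.
Proof. by move=> u; rewrite -(gr_reprK u) gr_addE add0r. Qed.
Fact gr_addN : left_inverse gr_zero gr_opp gr_add.
Proof. by move=> u; rewrite -(gr_reprK u) gr_oppE gr_addE addNr. Qed.

HB.instance Definition _ :=
  GRing.isZmodule.Build gr gr_addA gr_addC gr_add0 gr_addN.

Lemma gr_classD u v : gr_class (u + v) = gr_class u + gr_class v.
Proof. by rewrite -gr_addE. Qed.

Definition gr_homogeneous : set gr :=
  [set g | exists q, forall p, p != q -> g p = fil_pred p].

(* Junk value 0 at x = 0. *)
Definition fil_degree (x : V) : nat :=
  xget 0%N [set q | F q x /\ ~ fil_pred q x].

Lemma fil_degree_in x : F (fil_degree x) x.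
Proof.
rewrite /fil_degree; case: xgetP => [q _ []//|noq].
have [p Fp] := fil_cover F x.
elim: p Fp => [//|p IHp] Fp.
have [|nFp] := pselect (F p x); first exact: IHp.
by case: (noq p.+1).
Qed.

Definition tau (x : V) : rees := rees_homog (fil_degree_in x).

(* The coset x + F_(q-1) placed in degree q, where q = fil_degree x. *)
Definition sigma (x : V) : gr := gr_class (tau x).

End Graded.

Section Action.
Variables (K : fieldType) (A : algType K) (FA : alg_filtration A).

Lemma fil_le (V : zmodType) (F : filtration V) p q : (p <= q)%N -> F p `<=` F q.
Proof.
move=> /subnK<-; elim: (q - p)%N => [//|k IHk] x /IHk.
exact: filS.
Qed.

Section Module.
Variables (M : lmodType A) (FM : mod_filtration FA M).

Definition rees_act (f : rees FA) (u : rees FM) : rees FM.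
Proof.
exists (fun k => \sum_(i < k.+1) f i *: u (k - i)%N).
  move=> k; apply: fil_sum => i _; rewrite -[k in mod_fil FM k](subnKC (leq_ord i)).
  by apply: mod_filM; apply: rees_in.
have [[N fN] [N' uN]] := (rees_fin f, rees_fin u).
exists (N + N')%N => k le_k; apply: big1 => i _.
have [/fN->|lt_i] := leqP N i; first by rewrite scale0r.
rewrite uN ?scaler0 // leq_subRL ?leq_ord //.
by apply: leq_trans le_k; rewrite leq_add2r ltnW.
Defined.

Fact rees_actDr f : {morph rees_act f : u v / u + v}.
Proof.
move=> u v; apply: reesP => k /=; rewrite -big_split /=.
by apply: eq_bigr => i _; rewrite scalerDr.
Qed.

Fact rees_actDl u : {morph rees_act^~ u : f g / f + g}.
Proof.
move=> f g; apply: reesP => k /=; rewrite -big_split /=.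
by apply: eq_bigr => i _; rewrite scalerDl.
Qed.

Fact rees_act1 : left_id (rees_homog (alg_fil1 FA)) rees_act.
Proof.
move=> u; apply: reesP => k /=.
rewrite big_ord_recl subn0 scale1r big1 ?addr0 // => i _.
by rewrite scale0r.
Qed.

Lemma fil_pred_act p q x y : FA p x -> fil_pred FM q y ->
  fil_pred FM (p + q)%N (x *: y).
Proof.
case: q => [_ ->|q Fx Fy]; first by rewrite scaler0; apply: fil_pred0.
by rewrite addnS; apply: mod_filM.
Qed.

Lemma fil_pred_actl p q x y : fil_pred FA p x -> FM q y ->
  fil_pred FM (p + q)%N (x *: y).
Proof.
case: p => [-> _|p Fx Fy]; first by rewrite scale0r; apply: fil_pred0.
by apply: mod_filM.
Qed.

(* (x + F_(p-1)A) (y + F_(q-1)M) = x y + F_(p+q-1)M, extended bilinearly;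
   [gr_actE] states the independence of the representatives. *)
Definition gr_act (f : gr FA) (u : gr FM) : gr FM :=
  gr_class (rees_act (gr_repr f) (gr_repr u)).

Lemma gr_actE f u : gr_act (gr_class f) (gr_class u) = gr_class (rees_act f u).
Proof.
apply/gr_classP => k /=; rewrite -sumrB.
apply: big_ind => [||i _]; [exact: fil_pred0 | exact: fil_predD |].
set f' := gr_repr _; set u' := gr_repr _.
rewrite -(subrKA (f' i *: u (k - i)%N)) -scalerBr -scalerBl.
rewrite -[k in fil_pred _ k](subnKC (leq_ord i)).
apply: fil_predD.
  by apply: fil_pred_act; [apply: rees_in | apply: gr_classK].
by apply: fil_pred_actl; [apply: gr_classK | apply: rees_in].
Qed.

Fact gr_actDr f : {morph gr_act f : u v / u + v}.
Proof.
move=> u v; rewrite -(gr_reprK f) -(gr_reprK u) -(gr_reprK v).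
by rewrite -gr_classD !gr_actE -gr_classD rees_actDr.
Qed.

Fact gr_actDl u : {morph gr_act^~ u : f g / f + g}.
Proof.
move=> f g; rewrite -(gr_reprK u) -(gr_reprK f) -(gr_reprK g).
by rewrite -gr_classD !gr_actE -gr_classD rees_actDl.
Qed.

Fact gr_act1 : left_id (gr_class (rees_homog (alg_fil1 FA))) gr_act.
Proof. by move=> u; rewrite -(gr_reprK u) gr_actE rees_act1. Qed.

End Module.

Definition regular_filtration : mod_filtration FA A^o.
Proof.
exists (alg_fil FA : filtration A^o); last exact: alg_filM.
by move=> q k x; rewrite [_ *: _]mulr_algl; apply: alg_filZ.
Defined.

Definition rees_mul : rees FA -> rees FA -> rees FA :=
  @rees_act A^o regular_filtration.

Definition gr_mul : gr FA -> gr FA -> gr FA :=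
  @gr_act A^o regular_filtration.

Lemma rees_actA (M : lmodType A) (FM : mod_filtration FA M) f g (u : rees FM) :
  rees_act f (rees_act g u) = rees_act (rees_mul f g) u.
Proof.
apply: reesP => k /=.
pose e i j := f i *: (g j *: u (k - i - j)%N).
transitivity (\sum_(i < k.+1) \sum_(j < k.+1 | (j <= k - i)%N) e i j).
  apply: eq_bigr => i _; rewrite scaler_sumr.
  by rewrite (big_ord_narrow_leq (leq_subr _ _)).
transitivity (\sum_(i < k.+1) \sum_(l < k.+1 | (i <= l)%N) e i (l - i)%N).
  apply: eq_bigr => i _.
  pose E j := e i j.
  rewrite -(big_mkord (fun j => j <= k - i)%N E).
  rewrite -(big_mkord (fun l => i <= l)%N (fun l => E (l - i)%N)).
  have le_ik := leq_ord i.
  rewrite (big_cat_nat (n := (k - i).+1)) ?ltnS ?leq_subr //=.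
  rewrite [X in _ + X]big_nat_cond [X in _ + X]big1 ?addr0; last first.
    by move=> j /andP[/andP[lt_j _]]; rewrite leqNgt lt_j.
  rewrite [RHS](big_cat_nat (n := i)) ?(leqW le_ik) //=.
  rewrite [X in _ = X + _]big_nat_cond [X in _ = X + _]big1 ?add0r; last first.
    by move=> l /andP[/andP[_ lt_li]]; rewrite leqNgt lt_li.
  rewrite -[X in _ = \big[_/_]_(X <= _ < _ | _) _]add0n big_addn subSn //.
  rewrite big_nat_cond [RHS]big_nat_cond; apply: eq_big => j.
    by rewrite leq_addl ltnS andbT -andbA andbb.
  by rewrite addnK.
rewrite (exchange_big_dep predT) //=; apply: eq_bigr => l _.
rewrite scaler_suml (big_ord_narrow_leq (leq_ord l)) /=.
apply: eq_bigr => i _; rewrite /e scalerA -subnDA subnKC ?leq_ord //.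
Qed.

Lemma gr_mulE f g : gr_mul (gr_class f) (gr_class g) = gr_class (rees_mul f g).
Proof. exact: (@gr_actE A^o regular_filtration). Qed.

Lemma gr_actA (M : lmodType A) (FM : mod_filtration FA M) f g (u : gr FM) :
  gr_act f (gr_act g u) = gr_act (gr_mul f g) u.
Proof.
rewrite -(gr_reprK f) -(gr_reprK g) -(gr_reprK u).
by rewrite gr_mulE !gr_actE rees_actA.
Qed.

Let rees_one : rees FA := rees_homog (alg_fil1 FA).
Let gr_one : gr FA := gr_class rees_one.

Fact rees_mulA : associative rees_mul.
Proof. exact: (@rees_actA A^o regular_filtration). Qed.
Fact rees_mul1 : left_id rees_one rees_mul.
Proof. exact: (@rees_act1 A^o regular_filtration). Qed.
Fact rees_mulr1 : right_id rees_one rees_mul.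
Proof.
move=> f; apply: reesP => k /=.
rewrite big_ord_recr /= subnn [_ *: 1]mulr1 big1 ?add0r // => i _.
by rewrite subn_eq0 leqNgt ltn_ord scaler0.
Qed.
Fact rees_mulDl : left_distributive rees_mul +%R.
Proof. by move=> f g u; apply: (@rees_actDl A^o regular_filtration). Qed.
Fact rees_mulDr : right_distributive rees_mul +%R.
Proof. exact: (@rees_actDr A^o regular_filtration). Qed.

Fact gr_mulA : associative gr_mul.
Proof. exact: (@gr_actA A^o regular_filtration). Qed.
Fact gr_mul1 : left_id gr_one gr_mul.
Proof. exact: (@gr_act1 A^o regular_filtration). Qed.
Fact gr_mulr1 : right_id gr_one gr_mul.
Proof. by move=> f; rewrite -(gr_reprK f) gr_mulE rees_mulr1. Qed.
Fact gr_mulDl : left_distributive gr_mul +%R.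
Proof. by move=> f g u; apply: (@gr_actDl A^o regular_filtration). Qed.
Fact gr_mulDr : right_distributive gr_mul +%R.
Proof. exact: (@gr_actDr A^o regular_filtration). Qed.

Definition reesAlg := rees FA.
HB.instance Definition _ := GRing.Zmodule.on reesAlg.

Fact rees_one_neq0 : (rees_one : reesAlg) != 0.
Proof.
by apply/eqP => /(congr1 (fun u : rees FA => u 0%N)) /eqP; rewrite /= oner_eq0.
Qed.

HB.instance Definition _ := GRing.Zmodule_isNzRing.Build reesAlg
  rees_mulA rees_mul1 rees_mulr1 rees_mulDl rees_mulDr rees_one_neq0.

Definition grAlg := gr FA.
HB.instance Definition _ := GRing.Zmodule.on grAlg.

Fact gr_one_neq0 : (gr_one : grAlg) != 0.
Proof.
apply/eqP => /gr_classP /(_ 0%N) /= /eqP; rewrite subr0.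
by rewrite oner_eq0.
Qed.

HB.instance Definition _ := GRing.Zmodule_isNzRing.Build grAlg
  gr_mulA gr_mul1 gr_mulr1 gr_mulDl gr_mulDr gr_one_neq0.

Section ModuleInstances.
Variables (M : lmodType A) (FM : mod_filtration FA M).

Definition reesMod := rees FM.
HB.instance Definition _ := GRing.Zmodule.on reesMod.
HB.instance Definition _ := GRing.Zmodule_isLmodule.Build reesAlg reesMod
  (@rees_actA M FM) (@rees_act1 M FM) (@rees_actDr M FM) (@rees_actDl M FM).

Definition grMod := gr FM.
HB.instance Definition _ := GRing.Zmodule.on grMod.
HB.instance Definition _ := GRing.Zmodule_isLmodule.Build grAlg grMod
  (@gr_actA M FM) (@gr_act1 M FM) (@gr_actDr M FM) (@gr_actDl M FM).

Definition sigmaM (x : M) : grMod := sigma FM x.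
Definition tauM (x : M) : reesMod := tau FM x.
Definition grM_homogeneous : set grMod := @gr_homogeneous M FM.
Definition reesM_homogeneous : set reesMod := @rees_homogeneous M FM.

End ModuleInstances.
End Action.

Section Generation.
Variables (R : pzRingType) (N : lmodType R).

Definition generates (S : {fset N}) : Prop :=
  forall x : N, exists c : N -> R, x = \sum_(s <- S) c s *: s.

Definition minimal_homogeneous_generating_set (homogeneous : set N)
    (S : {fset N}) : Prop :=
  [/\ forall s, s \in S -> homogeneous s,
      generates S
    & forall T : {fset N}, (T `<` S)%fset -> ~ generates T].

End Generation.

Section Fbasis.
Variables (K : fieldType) (A : algType K) (FA : alg_filtration A).
Variables (M : lmodType A) (FM : mod_filtration FA M).

(* The sum of the subspaces F_p A over all p with p + d <= q. *)
Definition sum_fil (d q : nat) : set A :=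
  [set b | exists2 g : nat -> A, forall p, FA p (g p)
         & b = \sum_(p < q.+1 | (p + d <= q)%N) g p].

Definition Fbasis (V : {fset M}) : Prop :=
  0 \notin V /\
  exists d : M -> nat, forall q,
    FM q = [set x | exists2 b : M -> A, forall v, v \in V -> sum_fil (d v) q (b v)
                  & x = \sum_(v <- V) b v *: v].

Definition minimal_Fbasis (V : {fset M}) : Prop :=
  Fbasis V /\ forall W : {fset M}, (W `<` V)%fset -> ~ Fbasis W.

End Fbasis.

(* Main.v *)
Require Import Defs.
From HB Require Import structures.
From mathcomp Require Import all_boot all_order all_algebra finmap.
From mathcomp Require Import boolp classical_sets.

Import Order.TTheory GRing.Theory.
Local Open Scope ring_scope.

Set Implicit Arguments.
Unset Strict Implicit.

(** Call V a filtered generating set when every x in F_q M is a combination of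
the v in V with coefficients b_v in F_(q - deg v) A, the coefficient being 0 if
deg v > q. An F-basis is a filtered generating set without 0: whatever the
shifts n_v are in the definition, v belongs to F_(n_v) M, hence deg v <= n_v,
and the coefficient spaces only grow when n_v is replaced by deg v
([FbasisP]).

Filtered generation is generation of the Rees module by the tau v: the
component of degree q of c * tau v is c_(q - deg v) v, so the components of a
relation in the Rees module are exactly the filtered relations in all degrees
([filtered_gen_tau]). Taking classes is a surjective semilinear map from the
Rees module to G(M), so the sigma v then generate G(M); conversely generation
of G(M) writes x in F_q M as a filtered combination up to F_(q-1) M, and
induction on q concludes ([filtered_gen_sigma]). Since these equivalences hold
for every finite set, minimality is transported as well
([minimal_spansP]). The map tau is injective; sigma need not be, but it is on
a minimal V, because of two elements with the same class one is redundant.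

For the count, let L_q be the set of filtered combinations in degree q of the
elements of V of degree < q. It does not depend on V ([low_comb_sub]); it
corresponds to the degree q part of G(A)_+ G(M). Because the weights are
positive, F_0 A = K, so modulo L_q the elements of V of degree q span F_q M
over K ([filtered_gen_split]), and by minimality they are independent
([minimal_low_indep]). Two minimal F-bases thus give two bases of F_q M / L_q,
one for each, and comparing the two change-of-basis matrices shows that they
have the same number of elements in each degree. *)

(** * Families that span a module *)

Lemma fproperP {T : choiceType} {A B : {fset T}} :
  reflect ({subset A <= B} /\ exists2 x, x \in B & x \notin A) (A `<` B)%fset.
Proof.
rewrite fproperE; apply: (iffP andP) => -[/fsubsetP AB nBA].
  by split=> //; apply/fsubsetPn.
by split=> //; apply/fsubsetPn.
Qed.

Section Spanning.
Variables (R : pzRingType) (N : lmodType R) (I : choiceType) (f : I -> N).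

Definition lincomb (V : {fset I}) (x : N) : Prop :=
  exists c : I -> R, x = \sum_(v <- V) c v *: f v.

Definition spans (V : {fset I}) : Prop := forall x, lincomb V x.

Lemma lincomb0 V : lincomb V 0.
Proof. by exists (fun=> 0); rewrite big1 // => v _; rewrite scale0r. Qed.

Lemma lincombD V x y : lincomb V x -> lincomb V y -> lincomb V (x + y).
Proof.
move=> [c ->] [d ->]; exists (fun v => c v + d v).
by rewrite -big_split; apply: eq_bigr => v _; rewrite scalerDl.
Qed.

Lemma lincombZ V k x : lincomb V x -> lincomb V (k *: x).
Proof.
move=> [c ->]; exists (fun v => k * c v).
by rewrite scaler_sumr; apply: eq_bigr => v _; rewrite scalerA.
Qed.

Lemma lincomb_mem (V : {fset I}) v : v \in V -> lincomb V (f v).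
Proof.
move=> vV; exists (fun w => (w == v)%:R).
rewrite (big_fsetD1 v) //= eqxx scale1r big_seq big1 ?addr0 // => w.
by rewrite !inE => /andP[/negPf-> _]; rewrite scale0r.
Qed.

Lemma lincomb_sum V (J : choiceType) (W : {fset J}) (c : J -> R) (g : J -> N) :
  (forall w, w \in W -> lincomb V (g w)) ->
  lincomb V (\sum_(w <- W) c w *: g w).
Proof.
move=> gP; rewrite big_seq; apply: big_ind => [||w wW].
- exact: lincomb0.
- exact: lincombD.
- exact/lincombZ/gP.
Qed.

End Spanning.

Section Minimality.
Variables (R : pzRingType) (N : lmodType R) (I : choiceType) (f : I -> N).

Lemma spans_imfset (V : {fset I}) :
  spans f V <-> generates [fset f v | v in V]%fset.
Proof.
split=> sp x; have [c ->] := sp x.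
  apply: (@lincomb_sum _ _ _ id) => v vV; apply: (@lincomb_mem _ _ _ id).
  exact: in_imfset.
apply: (@lincomb_sum _ _ _ f _ _ _ _ id) => s /imfsetP[v /= vV ->].
exact: lincomb_mem.
Qed.

(** Subsets of the image of V are images of subsets of V, and f is injective
on a minimal V because dropping one of two elements with the same image does
not change the image. *)
Lemma minimal_spansP (hom : set N) (V : {fset I}) : (forall v, hom (f v)) ->
  spans f V /\ (forall W, (W `<` V)%fset -> ~ spans f W) <->
  {in V &, injective f} /\
  minimal_homogeneous_generating_set hom [fset f v | v in V]%fset.
Proof.
move=> hom_f; split=> [[spV minV]|[f_inj [_ genV minV]]].
- split=> [v w vV wV fvw|].
    apply: contrapT => /eqP neq_vw.
    apply: (minV (V `\ v)%fset); first exact: fproperD1.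
    apply/spans_imfset => x; have [c ->] := (spans_imfset V).1 spV x.
    apply: (@lincomb_sum _ _ _ id) => s /imfsetP[u /= uV ->].
    apply: (@lincomb_mem _ _ _ id); have [->|neq_uv] := eqVneq u v.
      by rewrite fvw in_imfset //= !inE eq_sym neq_vw.
    by rewrite in_imfset //= !inE neq_uv.
  split; first by move=> s /imfsetP[v _ ->].
    exact/spans_imfset.
  move=> T /fproperP[TV [s /imfsetP[v /= vV ->] nTv]] genT.
  apply: (minV [fset w in V | f w \in T]%fset).
    apply/fproperP; split=> [w|]; first by rewrite !inE => /andP[].
    by exists v => //; rewrite !inE negb_and nTv orbT.
  apply/spans_imfset; suff -> : [fset f w | w in [fset w in V | f w \in T]]%fset = T.
    by [].
  apply/fsetP => t; apply/imfsetP/idP => /= [[w]|tT].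
    by rewrite !inE => /andP[_ Tw] ->.
  have /imfsetP[w /= wV def_t] := TV t tT.
  by exists w; rewrite // !inE wV -def_t.
- split=> [|W /fproperP[WV [v vV nWv]] spW]; first exact/spans_imfset.
  apply: (minV [fset f w | w in W]%fset); last exact/spans_imfset.
  apply/fproperP; split=> [s /imfsetP[w /= wW ->]|].
    by rewrite in_imfset //=; apply: WV.
  exists (f v); first by rewrite in_imfset.
  apply: contra nWv => /imfsetP[w /= wW /f_inj->] //; exact: WV.
Qed.

End Minimality.

(** * Filtered combinations and F-bases *)

Lemma fil_degree_le {V : zmodType} {F : filtration V} {q x} :
  F q x -> (fil_degree F x <= q)%N.
Proof.
move=> Fx; rewrite /fil_degree; case: xgetP => [p _ [Fp nFp]|//].
rewrite leqNgt; apply/negP; case: p nFp {Fp} => [//|p] nFp lt_qp.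
by apply: nFp; apply: fil_le Fx.
Qed.

Section FilteredCombinations.
Variables (K : fieldType) (A : algType K) (FA : alg_filtration A).
Variables (M : lmodType A) (FM : mod_filtration FA M).

Local Notation deg := (fil_degree FM).

(** The filtration increases, so among the F_p A with p + d <= q the last one,
F_(q-d) A, contains all the others. *)
Lemma sum_filP d q b :
  sum_fil FA d q b <-> if (d <= q)%N then FA (q - d)%N b else b = 0.
Proof.
split=> [[g Fg ->]|].
  case: leqP => [le_dq|lt_qd]; last first.
    by rewrite big1 // => p; rewrite leqNgt ltn_addl.
  apply: fil_sum => p le_p; apply: fil_le (Fg p).
  by rewrite leq_subRL // addnC.
case: leqP => [le_dq Fb|lt_qd ->]; last first.
  by exists (fun=> 0) => [p|]; [apply: fil0 | rewrite big1].
exists (fun p => if p == (q - d)%N then b else 0) => [p|].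
  by case: eqP => [->|_] //; apply: fil0.
have lt_qd : (q - d < q.+1)%N by rewrite ltnS leq_subr.
rewrite (bigD1 (Ordinal lt_qd)) /= ?subnK // eqxx big1 ?addr0 // => p.
by case/andP=> _; rewrite -val_eqE /= => /negPf->.
Qed.

Lemma sum_fil0 d q : sum_fil FA d q 0.
Proof. by apply/sum_filP; case: ifP => // _; apply: fil0. Qed.

Lemma sum_filD d q b c :
  sum_fil FA d q b -> sum_fil FA d q c -> sum_fil FA d q (b + c).
Proof.
move=> /sum_filP Fb /sum_filP Fc; apply/sum_filP; case: ifP Fb Fc => _.
  exact: filD.
by move=> -> ->; rewrite addr0.
Qed.

Lemma sum_filM d p q b c :
  sum_fil FA p q b -> sum_fil FA d p c -> sum_fil FA d q (b * c).
Proof.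
move=> /sum_filP; case: leqP => [le_pq Fb|_ -> _]; last first.
  by rewrite mul0r; apply: sum_fil0.
move=> /sum_filP; case: leqP => [le_dp Fc|_ ->]; last first.
  by rewrite mulr0; apply: sum_fil0.
apply/sum_filP; rewrite (leq_trans le_dp le_pq).
have -> : (q - d = (q - p) + (p - d))%N by rewrite addnBA // subnK.
exact: alg_filM.
Qed.

Lemma sum_filZ q k : sum_fil FA q q k%:A.
Proof. by apply/sum_filP; rewrite leqnn subnn; apply/alg_filZ/alg_fil1. Qed.

Lemma sum_fil1 q : sum_fil FA q q 1.
Proof. by rewrite -(scale1r 1); apply: sum_filZ. Qed.

Definition filtered_comb (V : {fset M}) (q : nat) (x : M) : Prop :=
  exists2 b : M -> A, forall v, v \in V -> sum_fil FA (deg v) q (b v)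
                    & x = \sum_(v <- V) b v *: v.

Definition filtered_gen (V : {fset M}) : Prop :=
  forall q x, FM q x -> filtered_comb V q x.

Lemma filtered_comb0 V q : filtered_comb V q 0.
Proof.
exists (fun=> 0) => [v _|]; first exact: sum_fil0.
by rewrite big1 // => v _; rewrite scale0r.
Qed.

Lemma filtered_combD V q x y :
  filtered_comb V q x -> filtered_comb V q y -> filtered_comb V q (x + y).
Proof.
move=> [b Fb ->] [c Fc ->]; exists (fun v => b v + c v) => [v vV|].
  by apply: sum_filD; [apply: Fb | apply: Fc].
by rewrite -big_split; apply: eq_bigr => v _; rewrite scalerDl.
Qed.

Lemma filtered_combZ V p q b x :
  sum_fil FA p q b -> filtered_comb V p x -> filtered_comb V q (b *: x).
Proof.
move=> Fb [c Fc ->]; exists (fun v => b * c v) => [v vV|].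
  by apply: sum_filM Fb _; apply: Fc.
by rewrite scaler_sumr; apply: eq_bigr => v _; rewrite scalerA.
Qed.

Lemma filtered_combN V q x : filtered_comb V q x -> filtered_comb V q (- x).
Proof.
move=> Vx; rewrite -scaleN1r -(scaleN1r 1); apply: filtered_combZ Vx.
exact: sum_filZ.
Qed.

Lemma filtered_comb_sum V q (I : eqType) (r : seq I) (P : pred I) (E : I -> M) :
  (forall i, i \in r -> P i -> filtered_comb V q (E i)) ->
  filtered_comb V q (\sum_(i <- r | P i) E i).
Proof.
move=> EP; rewrite big_seq_cond; apply: big_ind => [||i /andP[]].
- exact: filtered_comb0.
- exact: filtered_combD.
- exact: EP.
Qed.

Lemma filtered_comb_mem (V : {fset M}) v :
  v \in V -> filtered_comb V (deg v) v.
Proof.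
move=> vV; exists (fun w => (w == v)%:R) => [w _|].
  by case: eqP => [->|_]; [apply: sum_fil1 | apply: sum_fil0].
rewrite (big_fsetD1 v) //= eqxx scale1r big_seq big1 ?addr0 // => w.
by rewrite !inE => /andP[/negPf-> _]; rewrite scale0r.
Qed.

Lemma filtered_comb_trans (U V : {fset M}) q x :
  (forall u, u \in U -> filtered_comb V (deg u) u) ->
  filtered_comb U q x -> filtered_comb V q x.
Proof.
move=> UV [b Fb ->]; apply: filtered_comb_sum => u uU _.
by apply: filtered_combZ (Fb u uU) _; apply: UV.
Qed.

Lemma filtered_comb_sub (U V : {fset M}) q x : (U `<=` V)%fset ->
  filtered_comb U q x -> filtered_comb V q x.
Proof.
move=> /fsubsetP UV; apply: filtered_comb_trans => u /UV.
exact: filtered_comb_mem.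
Qed.

Lemma filtered_comb_restrict V q x : filtered_comb V q x ->
  filtered_comb [fset v in V | (deg v <= q)%N]%fset q x.
Proof.
move=> [b Fb ->]; apply: filtered_comb_sum => v vV _.
have /sum_filP := Fb v vV; case: leqP => [le_vq _|_ ->].
  apply: filtered_combZ (Fb v vV) _; apply: filtered_comb_mem.
  by rewrite !inE vV.
by rewrite scale0r; apply: filtered_comb0.
Qed.

Lemma filtered_comb_in V q x : filtered_comb V q x -> FM q x.
Proof.
move=> [b Fb ->]; rewrite big_seq; apply: fil_sum => v vV.
have /sum_filP := Fb v vV; case: leqP => [le_vq Fbv|_ ->].
  by rewrite -[q](subnK le_vq); apply: mod_filM Fbv _; apply: fil_degree_in.
by rewrite scale0r; apply: fil0.
Qed.

(** The shifts in the definition of an F-basis may be taken to be the filtered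
degrees: applied to q = d v and x = v, the definition gives v in F_(d v) M. *)
Lemma FbasisP V : Fbasis FM V <-> 0 \notin V /\ filtered_gen V.
Proof.
split=> [[V0 [d FMd]]|[V0 gV]]; split=> //; last first.
  exists deg => q; apply/seteqP; split=> x; first exact: gV.
  exact: filtered_comb_in.
have le_deg v : v \in V -> (deg v <= d v)%N.
  move=> vV; apply: fil_degree_le; rewrite FMd.
  exists (fun w => (w == v)%:R) => [w _|].
    by case: eqP => [->|_]; [apply: sum_fil1 | apply: sum_fil0].
  rewrite (big_fsetD1 v) //= eqxx scale1r big_seq big1 ?addr0 // => w.
  by rewrite !inE => /andP[/negPf-> _]; rewrite scale0r.
move=> q x; rewrite FMd => -[b Fb def_x]; exists b => // v vV.
apply/sum_filP; have /sum_filP := Fb v vV; case: leqP => [le_dq Fbv|_ ->].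
  rewrite (leq_trans (le_deg v vV) le_dq); apply: fil_le Fbv.
  exact: leq_sub2l (le_deg v vV).
by case: ifP => // _; apply: fil0.
Qed.

Lemma minimal_FbasisP (V : {fset M}) : 0 \notin V -> minimal_Fbasis FM V <->
  filtered_gen V /\ (forall W, (W `<` V)%fset -> ~ filtered_gen W).
Proof.
move=> V0; split=> [[/FbasisP[_ gV] minV]|[gV minV]]; split=> //.
- move=> W WV gW; apply: (minV W) => //; apply/FbasisP; split=> //.
  by apply: contra V0; apply: fsubsetP; apply: fproper_sub.
- exact/FbasisP.
- by move=> W WV /FbasisP[_]; apply: minV.
Qed.

(** * The Rees module and the associated graded module *)

(** The coefficient of v in the degree q component of c * tau v, when v has
filtered degree d. *)
Definition rees_coef (c : rees FA) (d q : nat) : A :=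
  if (d <= q)%N then c (q - d)%N else 0.

Lemma rees_coefP c d q : sum_fil FA d q (rees_coef c d q).
Proof.
by apply/sum_filP; rewrite /rees_coef; case: leqP => // _; apply: rees_in.
Qed.

Lemma rees_act_tauE (c : rees FA) (v : M) q :
  rees_act c (tau FM v) q = rees_coef c (deg v) q *: v.
Proof.
rewrite /= /rees_coef; case: leqP => [le_vq|lt_qv]; last first.
  rewrite scale0r; apply: big1 => i _; rewrite ifN ?scaler0 //.
  by rewrite neq_ltn (leq_ltn_trans (leq_subr _ _) lt_qv).
have lt_i : (q - deg v < q.+1)%N by rewrite ltnS leq_subr.
rewrite (bigD1 (Ordinal lt_i)) //= subKn // eqxx big1 ?addr0 // => i.
rewrite -val_eqE /= => neq_i; rewrite ifN ?scaler0 //.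
by apply: contra neq_i => /eqP<-; rewrite subKn // leq_ord.
Qed.

Lemma rees_sumE (I : Type) (r : seq I) (E : I -> rees FM) q :
  (\sum_(i <- r) E i) q = \sum_(i <- r) E i q.
Proof. by elim/big_rec2: _ => // i y x _ <-. Qed.

Lemma tauM_inj : injective (tauM FM).
Proof.
move=> x y eq_xy.
have eq_at p : (if p == deg x then x else 0) = (if p == deg y then y else 0).
  exact: (congr1 (fun u : rees FM => u p) eq_xy).
have [eq_d|neq_d] := eqVneq (deg x) (deg y).
  by have := eq_at (deg x); rewrite -eq_d eqxx.
have := eq_at (deg x); rewrite eqxx (negPf neq_d) => x0.
by have := eq_at (deg y); rewrite eqxx eq_sym (negPf neq_d) {1}x0.
Qed.

(** The coefficients of v in a relation of the Rees module form one family: its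
member of index p is the coefficient of v in the filtered relation of degree
p + deg v. Relations in degrees where the element vanishes are chosen to be
trivial, so that the family has finite support. *)
Lemma filtered_gen_tau V : filtered_gen V <-> spans (tauM FM) V.
Proof.
split=> [gV u|sp q x Fx].
- have [N uN] := rees_fin u.
  have /choice[b bP] : forall q, exists b : M -> A,
      [/\ forall v, v \in V -> sum_fil FA (deg v) q (b v),
          u q = \sum_(v <- V) b v *: v
        & (N <= q)%N -> forall v, b v = 0].
    move=> q; have [/uN uq0|_] := leqP N q.
      exists (fun=> 0); split=> // [v _|]; first exact: sum_fil0.
      by rewrite uq0 big1 // => v _; rewrite scale0r.
    by have [b Fb def_u] := gV q (u q) (rees_in u q); exists b.
  pose e v p := if v \in V then b (p + deg v)%N v else 0.
  have Fe v p : FA p (e v p).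
    rewrite /e; case: ifP => [vV|_]; last exact: fil0.
    have [/(_ v vV)/sum_filP + _ _] := bP (p + deg v)%N.
    by rewrite leq_addl addnK.
  have e_fin v : exists N, forall p, (N <= p)%N -> e v p = 0.
    exists N => p le_Np; rewrite /e; case: ifP => // _.
    have [_ _ ->] // := bP (p + deg v)%N.
    by rewrite (leq_trans le_Np) ?leq_addr.
  exists (fun v => Rees (Fe v) (e_fin v) : reesAlg FA).
  apply: reesP => q; rewrite rees_sumE; have [Fb -> _] := bP q.
  rewrite big_seq [RHS]big_seq; apply: eq_bigr => v vV.
  rewrite [RHS]rees_act_tauE /rees_coef /= /e vV.
  by have /sum_filP := Fb v vV; case: leqP => [/subnK-> //|_ ->].
- have [c def_x] := sp (rees_homog Fx : reesMod FM).
  have {def_x} := congr1 (fun u : rees FM => u q) def_x.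
  rewrite rees_sumE /= eqxx => def_x.
  exists (fun v => rees_coef (c v) (deg v) q) => [v _|].
    exact: rees_coefP.
  by rewrite {}def_x; apply: eq_bigr => v _; rewrite [LHS]rees_act_tauE.
Qed.

Lemma gr_class_lincomb (V : {fset M}) (c : M -> reesAlg FA) (f : M -> reesMod FM) :
  gr_class (\sum_(v <- V) c v *: f v : rees FM) =
  \sum_(v <- V) (gr_class (c v : rees FA) : grAlg FA) *:
                (gr_class (f v : rees FM) : grMod FM) :> grMod FM.
Proof.
rewrite (@big_morph _ _ (@gr_class M FM : reesMod FM -> grMod FM) 0 +%R 0 +%R) //.
  by apply: eq_bigr => v _; rewrite [RHS]gr_actE.
exact: gr_classD.
Qed.

(** If the classes generate G(M), then each x in F_q M is a filtered combination
up to an error in F_(q-1) M, and the error is treated by induction on q; it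
vanishes for q = 0. In the other direction a relation in the Rees module is
mapped to G(M). *)
Lemma filtered_gen_sigma V : filtered_gen V <-> spans (sigmaM FM) V.
Proof.
split=> [/filtered_gen_tau sp g|sp].
  have [u <-] := gr_class_surj g; have [c def_u] := sp u.
  exists (fun v => gr_class (c v : rees FA)).
  by rewrite [u in LHS]def_u gr_class_lincomb.
have approx q x : FM q x -> exists2 y, filtered_comb V q y & fil_pred FM q (x - y).
  move=> Fx; have [c def_x] := sp (gr_class (rees_homog Fx)).
  pose c' v : reesAlg FA := gr_repr (c v : gr FA).
  exists (\sum_(v <- V) rees_act (c' v) (tau FM v) q).
    exists (fun v => rees_coef (c' v) (deg v) q) => [v _|].
      exact: rees_coefP.
    by apply: eq_bigr => v _; rewrite rees_act_tauE.
  have /gr_classP/(_ q) : gr_class (rees_homog Fx) =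
      gr_class (\sum_(v <- V) c' v *: tauM FM v : reesMod FM).
    rewrite [LHS]def_x [RHS]gr_class_lincomb.
    by apply: eq_bigr => v _; rewrite gr_reprK.
  by rewrite rees_sumE /= eqxx.
elim=> [|q IHq] x Fx; have [y Vy /= Fxy] := approx _ _ Fx.
  by move/eqP: Fxy; rewrite subr_eq0 => /eqP->.
rewrite -(subrK y x); apply: filtered_combD => //.
rewrite -[x - y]scale1r; apply: filtered_combZ (IHq _ Fxy).
apply/sum_filP; rewrite leqnSn; apply: fil_le (alg_fil1 FA) => //.
Qed.

Lemma tauM_homogeneous v : reesM_homogeneous (tauM FM v).
Proof. by exists (deg v) => p /negPf neq_p /=; rewrite neq_p. Qed.

Lemma sigmaM_homogeneous v : grM_homogeneous (sigmaM FM v).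
Proof. by exists (deg v) => p /negPf neq_p /=; rewrite neq_p coset0. Qed.

(** * Minimal F-bases have the same degrees *)

(** The elements of V of degree less than q; their filtered combinations in
degree q form the space L_q described above. *)
Definition below (V : {fset M}) (q : nat) : {fset M} :=
  [fset v in V | (deg v < q)%N]%fset.

Definition layer (V : {fset M}) (q : nat) : {fset M} :=
  [fset v in V | deg v == q]%fset.

(** This gives the independence of L_q from the generating set: an element w of
degree less than q is a filtered combination of elements of degree at most
deg w, by which it may be replaced. *)
Lemma low_comb_sub V W q x : filtered_gen V ->
  filtered_comb (below W q) q x -> filtered_comb (below V q) q x.
Proof.
move=> gV; apply: filtered_comb_trans => w; rewrite !inE => /andP[_ lt_wq].
have /filtered_comb_restrict := gV _ _ (fil_degree_in FM w).
apply: filtered_comb_sub; apply/fsubsetP => v; rewrite !inE => /andP[-> le_vw].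
exact: leq_ltn_trans lt_wq.
Qed.

(** In a filtered combination of degree q, the coefficients of the elements of
degree q lie in F_0 A = K; the other terms make up an element of L_q. *)
Lemma filtered_gen_split V q x :
  (forall b, FA 0 b -> exists k : K, b = k%:A) ->
  filtered_gen V -> FM q x ->
  exists k : M -> K,
    filtered_comb (below V q) q (x - \sum_(v <- layer V q) (k v)%:A *: v).
Proof.
move=> FA0 gV /gV[b Fb def_x].
have /choice[k kP] : forall v, exists k : K, v \in layer V q -> b v = k%:A.
  move=> v; have [|_] := boolP (v \in layer V q); last by exists 0.
  rewrite !inE => /andP[vV /eqP def_q].
  have /sum_filP := Fb v vV; rewrite def_q leqnn subnn => /FA0[k ->].
  by exists k.
exists k.
have -> : \sum_(v <- layer V q) (k v)%:A *: v =
          \sum_(v <- V | deg v == q) b v *: v.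
  transitivity (\sum_(v <- layer V q) b v *: v); last by rewrite big_fset.
  by rewrite big_seq [RHS]big_seq; apply: eq_bigr => v /kP->.
rewrite {}def_x (bigID (fun v => deg v == q)) /= addrAC subrr add0r.
apply: filtered_comb_sum => v vV neq_vq; have /sum_filP := Fb v vV.
case: leqP => [le_vq _|_ ->]; last by rewrite scale0r; apply: filtered_comb0.
apply: filtered_combZ (Fb v vV) _; apply: filtered_comb_mem.
by rewrite !inE vV ltn_neqAle neq_vq.
Qed.

(** If k v0 is nonzero, the relation expresses v0 as a filtered combination of
the other elements of V, and substituting this expression for v0 shows that the
others still form a filtered generating set. *)
Lemma minimal_low_indep V q (k : M -> K) : filtered_gen V ->
  (forall W, (W `<` V)%fset -> ~ filtered_gen W) ->
  filtered_comb (below V q) q (\sum_(v <- layer V q) (k v)%:A *: v) ->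
  forall v, v \in layer V q -> k v = 0.
Proof.
move=> gV minV low v0 v0q; apply: contrapT => /eqP kv0.
have := v0q; rewrite !inE => /andP[v0V /eqP deg_v0].
apply: (minV (V `\ v0)%fset); first exact: fproperD1.
move=> p x /gV; apply: filtered_comb_trans => v vV.
have [->|neq_v] := eqVneq v v0; last first.
  by apply: filtered_comb_mem; rewrite !inE neq_v.
rewrite deg_v0; suff : filtered_comb (V `\ v0)%fset q ((k v0)%:A *: v0).
  move/(filtered_combZ (sum_filZ q (k v0)^-1)).
  by rewrite scalerA mulr_algl scalerA mulVf // !scale1r.
move: low; rewrite (big_fsetD1 v0) //=.
set y := \sum_(_ <- _) _ => low; rewrite -[_ *: v0](addrK y).
apply: filtered_combD.
  apply: filtered_comb_sub low; apply/fsubsetP => w.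
  rewrite !inE => /andP[-> lt_wq]; rewrite andbT.
  by apply: contraTneq lt_wq => ->; rewrite deg_v0 ltnn.
apply: filtered_combN; apply: filtered_comb_sum => w.
rewrite !inE => /andP[neq_w /andP[wV /eqP deg_w]] _.
apply: filtered_combZ (sum_filZ q _) _; rewrite -deg_w.
by apply: filtered_comb_mem; rewrite !inE neq_w.
Qed.

(** Write the v of degree q in terms of the w of degree q modulo L_q with a
matrix P, and the w in terms of the v with a matrix Q. Then P Q = 1 by the
independence of the v, so there are at most as many v as w. *)
Lemma leq_layer V W q :
  (forall b, FA 0 b -> exists k : K, b = k%:A) ->
  filtered_gen V -> (forall U, (U `<` V)%fset -> ~ filtered_gen U) ->
  filtered_gen W -> (#|` layer V q| <= #|` layer W q|)%N.
Proof.
move=> FA0 gV minV gW.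
(* Coordinates modulo L_q, which is taken with respect to V in both cases. *)
have change U : filtered_gen U -> exists k : M -> M -> K, forall x, FM q x ->
    filtered_comb (below V q) q (x - \sum_(u <- layer U q) (k x u)%:A *: u).
  move=> gU; have /choice[k kP] : forall x, exists kx : M -> K, FM q x ->
      filtered_comb (below V q) q (x - \sum_(u <- layer U q) (kx u)%:A *: u).
    move=> x; have [Fx|nFx] := pselect (FM q x); last by exists (fun=> 0).
    have [k low] := filtered_gen_split FA0 gU Fx; exists k => _.
    exact: low_comb_sub low.
  by exists k.
have [[kV kVP] [kW kWP]] := (change V gV, change W gW).
have layer_in U u : u \in layer U q -> FM q u.
  by rewrite !inE => /andP[_ /eqP<-]; apply: fil_degree_in.
(* The difference of 1 and the product is a relation between the elements of
   degree q of V modulo L_q, obtained by substituting the expression of each w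
   in the expression of v. *)
have inverse v : v \in layer V q -> forall v', v' \in layer V q ->
    \sum_(w <- layer W q) kW v w * kV w v' = (v' == v)%:R.
  move=> vq v' v'q; apply/eqP; rewrite eq_sym -subr_eq0; apply/eqP.
  pose k u := (u == v)%:R - \sum_(w <- layer W q) kW v w * kV w u.
  apply: (minimal_low_indep (k := k) gV minV) v'q.
  have -> : \sum_(u <- layer V q) (k u)%:A *: u =
      (v - \sum_(w <- layer W q) (kW v w)%:A *: w) +
      \sum_(w <- layer W q) (kW v w)%:A *:
         (w - \sum_(u <- layer V q) (kV w u)%:A *: u).
    under [X in _ = _ + X]eq_bigr => w _ do rewrite scalerBr.
    rewrite sumrB subrKA.
    under [X in _ = _ - X]eq_bigr => w _ do rewrite scaler_sumr.
    rewrite exchange_big /= /k.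
    under eq_bigr => u _ do rewrite scalerBl scalerBl.
    rewrite sumrB; congr (_ - _).
      rewrite (big_fsetD1 v) //= eqxx !scale1r big_seq big1 ?addr0 // => u.
      by rewrite !inE => /andP[/negPf-> _]; rewrite !scale0r.
    apply: eq_bigr => u _; rewrite scaler_suml scaler_suml.
    by apply: eq_bigr => w _; rewrite [RHS]scalerA mulr_algl scalerA.
  apply: filtered_combD; first exact/kWP/(layer_in V).
  apply: filtered_comb_sum => w wq _; apply: filtered_combZ (sum_filZ q _) _.
  exact/kVP/(layer_in W).
pose r := #|` layer V q|; pose s := #|` layer W q|.
pose nV i := nth 0 (layer V q) i; pose nW j := nth 0 (layer W q) j.
apply: (@mulmx1_min K r s (\matrix_(i, j) kW (nV i) (nW j))
                          (\matrix_(j, i) kV (nW j) (nV i))).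
apply/matrixP => i i'; rewrite !mxE.
under eq_bigr => j _ do rewrite !mxE.
transitivity (\sum_(w <- layer W q) kW (nV i) w * kV w (nV i')).
  by rewrite (big_nth 0) big_mkord.
by rewrite inverse ?mem_nth // nth_uniq ?fset_uniq // eq_sym.
Qed.

End FilteredCombinations.

(** Weights are positive, so the only monomial of degree 0 is 1. *)
Lemma weight_fil0_scalar (K : fieldType) (A : algType K) (n : nat)
    (a : 'I_n -> A) (m : 'I_n -> nat) :
  (forall i, (0 < m i)%N) ->
  forall b, weight_fil a m 0 b -> exists k : K, b = k%:A.
Proof.
move=> m_gt0 b [s [Ss ->]]; exists (\sum_(x <- s) x.1).
rewrite scaler_suml big_seq [RHS]big_seq; apply: eq_bigr => x xs.
have [al] := Ss x xs; rewrite leqn0 sum_nat_eq0 => /forallP al0 ->.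
rewrite /mon big1 // => i _; have := al0 i.
by rewrite muln_eq0 eqn0Ngt m_gt0 => /eqP->; rewrite expr0.
Qed.

Lemma eq_card_layers (I : choiceType) (f : I -> nat) (V W : {fset I}) :
  (forall q, #|` [fset v in V | f v == q]| = #|` [fset w in W | f w == q]|)%fset ->
  #|` V| = #|` W|.
Proof.
have card_layer (U : {fset I}) q :
    #|` [fset u in U | f u == q]%fset| = count_mem q (map f U).
  by rewrite card_fset_sum1 big_fset /= sum1_count count_map.
move=> eqVW; rewrite -(size_map f V) -(size_map f W); apply: perm_size.
by apply/allP => q _ /=; rewrite -!card_layer eqVW.
Qed.

Unset Implicit Arguments.

Theorem proposition4p4 (K : fieldType) (A : algType K) (n : nat)
  (a : 'I_n -> A) (prec : rel (expo n))
  (solvA : solvable_polynomial_algebra a prec)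
  (m : 'I_n -> nat) (m_gt0 : forall i, (0 < m i)%N)
  (filA : weighted_filtered a m)
  (M : lmodType A) (FM : mod_filtration (weight_filtration solvA filA) M) :
  (forall V : {fset M}, 0 \notin V ->
     (minimal_Fbasis FM V <->
        {in V &, injective (sigmaM FM)} /\
        minimal_homogeneous_generating_set (@grM_homogeneous _ _ _ _ FM)
          [fset sigmaM FM v | v in V]%fset) /\
     (minimal_Fbasis FM V <->
        minimal_homogeneous_generating_set (@reesM_homogeneous _ _ _ _ FM)
          [fset tauM FM v | v in V]%fset)) /\
  (forall V W : {fset M}, minimal_Fbasis FM V -> minimal_Fbasis FM W ->
     #|` V| = #|` W| /\
     forall q : nat, #|` [fset v in V | fil_degree FM v == q]%fset| =
                     #|` [fset w in W | fil_degree FM w == q]%fset|).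
Proof.
split=> [V V0|V W minV minW].
  have transport (R : pzRingType) (N : lmodType R) (f : M -> N) :
      (forall U, filtered_gen FM U <-> spans f U) ->
      minimal_Fbasis FM V <->
      spans f V /\ forall U, (U `<` V)%fset -> ~ spans f U.
    move=> gP; apply: (iff_trans (minimal_FbasisP FM V0)).
    by split=> -[/gP gV minV]; split=> // U UV /gP; apply: minV.
  split.
    apply: (iff_trans (transport _ _ _ (filtered_gen_sigma FM))).
    exact/minimal_spansP/sigmaM_homogeneous.
  apply: (iff_trans (transport _ _ _ (filtered_gen_tau FM))).
  apply: (iff_trans (minimal_spansP V (@tauM_homogeneous _ _ _ _ FM))).
  by split=> [[]|minV] //; split=> // v w _ _ /tauM_inj.
have [[[V0 _] _] [[W0 _] _]] := (minV, minW).
have [gV {}minV] := (minimal_FbasisP FM V0).1 minV.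
have [gW {}minW] := (minimal_FbasisP FM W0).1 minW.
have FA0 := weight_fil0_scalar (a := a) m_gt0.
have eq_layer q : #|` layer FM V q| = #|` layer FM W q|.
  by apply/eqP; rewrite eqn_leq !(leq_layer (FM := FM)).
by split=> //; apply: eq_card_layers eq_layer.
Qed.
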